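(* Let $t\ge 0$ be an integer. In the exponential-edge chip-firing process beginning with $2^{t+2}$ chips with distinct labels at site $0$, the final configuration (when no firing move is possible) has all chips in weakly sorted order: for any chips $a<b$, the final position of $a$ is at most the final position of $b$, regardless of the choices of firing moves made.
   Context: Exponential-edge graph with parameter $t$: the vertex set is $\mathbb{Z}$; for each $0\le k\le t$ there are $2^{t-k}$ parallel edges between $k$ and $k+1$ and $2^{t-k}$ parallel edges between $-k$ and $-k-1$; all other pairs of adjacent integers are joined by a single edge. If a site has $a$ edges to its left neighbor and $b$ edges to its right neighbor, a firing move at that site chooses $a+b$ chips present there and sends the $a$ smallest of them to the left neighbor and the $b$ largest to the right neighbor. *)

(* Defs.v *)
From mathcomp Require Import all_boot all_order all_algebra.
Set Implicit Arguments. Unset Strict Implicit. Unset Printing Implicit Defensive.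
Import Order.TTheory GRing.Theory Num.Theory.
Local Open Scope ring_scope.

(* Number of parallel edges between sites i and i+1 of the exponential-edge
   graph with parameter t:
   - for 0 <= k <= t, 2^(t-k) edges between k and k+1 (i = k);
   - for 0 <= k <= t, 2^(t-k) edges between -k-1 and -k (i = -k-1, so k = |i|-1);
   - otherwise a single edge. *)
Definition nedges (t : nat) (i : int) : nat :=
  if (0 <= i) && (i <= t%:Z) then (2 ^ (t - `|i|))%N
  else if (- (t%:Z) - 1 <= i) && (i < 0) then (2 ^ (t - (`|i|).-1))%N
  else 1%N.

Definition left_edges (t : nat) (x : int) : nat := nedges t (x - 1).
Definition right_edges (t : nat) (x : int) : nat := nedges t x.

(* A configuration of N labelled chips: chip i (label i, labels ordered as
   naturals) sits at site c i. *)
Definition config (N : nat) := {ffun 'I_N -> int}.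

Definition chips_at (N : nat) (c : config N) (x : int) : {set 'I_N} :=
  [set i | c i == x].

(* One firing move at site x using the set S of a+b chips present at x:
   the a smallest chips of S move to x-1, the b largest to x+1. *)
Definition fire (t N : nat) (c c' : config N) : Prop :=
  exists (x : int) (S : {set 'I_N}),
    [/\ S \subset chips_at c x,
        #|S| = (left_edges t x + right_edges t x)%N &
        c' = [ffun i => if i \in S then
                          (if (#|[set j in S | (j < i)%N]| < left_edges t x)%N
                           then x - 1 else x + 1)
                        else c i]].

Inductive reachable (t N : nat) (c : config N) : config N -> Prop :=
| reach_refl : reachable t c c
| reach_step : forall c1 c2, reachable t c c1 -> fire t c1 c2 -> reachable t c c2.

Definition stable (t N : nat) (c : config N) : Prop :=
  forall x : int, (#|chips_at c x| < left_edges t x + right_edges t x)%N.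

Definition init_config (N : nat) : config N := [ffun _ => 0].

(* Main.v *)
(* Let f(x) be the number of firings at x so far, and d_j = f(j) - f(j+1) for j >= 0, so that
   exactly 2^(t-j) d_j chips lie at sites > j. Counting shows that d_j stays in {0, 1, 2} and that
   site j+1 can fire only when d_j = 2 and d_{j+1} <= 1; unless d_{j+1} = 0, such a firing uses all
   chips of the site. Let T_j be the set of the 2^(t+1-j) largest chips, which is how many chips
   finally lie at sites > j. A firing at site j sends |T_{j+1}| chips to the right, hence
   never moves a chip of T_{j+1} to the left; so T_{j+1} lies at sites > j whenever d_j = 2, and
   then a firing at j+1 involves so many chips of T_{j+1} that only such chips move to the right.
   Thus only chips of T_{j+1} ever reach sites > j+1. For the middle threshold T_0: once site 1 has
   been emptied by a firing, only chips of T_1 are at positive sites when site 0 fires, and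
   symmetrically on the left, so that the firing at 0 correctly splits the middle half of the
   chips. In a stable configuration d_0 = ... = d_t = 2 and d_{t+1} = 1, and by counting the chips
   at sites > j are exactly T_j; mirroring the labels and the line gives the same on the left. *)
Require Import Defs.
From mathcomp Require Import all_boot all_order all_algebra.
From mathcomp Require Import zify.
Import Order.TTheory GRing.Theory Num.Theory.
Local Open Scope ring_scope.

Set Implicit Arguments. Unset Strict Implicit. Unset Printing Implicit Defensive.

(** * Edge multiplicities and their reflection symmetry *)

Lemma nedges_nat (t k : nat) : nedges t k%:Z = (2 ^ (t - k))%N.
Proof.
rewrite /nedges lez_nat /=; case: leqP => // lt_tk.
have -> /= : (k%:Z < 0) = false by lia.
by rewrite andbF; have -> : (t - k = 0)%N by lia.
Qed.

Lemma nedges_opp (t : nat) (x : int) : nedges t (- x - 1) = nedges t x.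
Proof.
rewrite /nedges; case: (boolP (0 <= x)) => x0.
  have -> /= : (0 <= - x - 1) = false by lia.
  have -> : (- x - 1 < 0) by lia.
  have -> : (- t%:Z - 1 <= - x - 1) = (x <= t) by lia.
  rewrite andbT; case: ifP => _.
    by have -> : `|(- x - 1)%R|.-1 = `|x|%N by lia.
  have -> : (x < 0) = false by lia. by rewrite andbF.
have -> /= : (0 <= - x - 1) by lia.
have -> : (- t%:Z - 1 <= x) = (- x - 1 <= t) by lia.
have -> : x < 0 by lia.
rewrite andbT; case: ifP => _.
  by have -> : `|(- x - 1)%R|%N = `|x|%N.-1 by lia.
have -> : (- x - 1 < 0) = false by lia.
by rewrite andbF.
Qed.

Lemma left_edges_nat (t k : nat) : left_edges t k.+1%:Z = (2 ^ (t - k))%N.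
Proof. by rewrite /left_edges -nedges_nat; congr nedges; lia. Qed.

Lemma left_edges0 (t : nat) : left_edges t 0 = (2 ^ t)%N.
Proof.
by rewrite /left_edges -nedges_opp (_ : - (0 - 1) - 1 = 0%N%:Z) ?nedges_nat ?subn0.
Qed.

Lemma right_edges_nat (t k : nat) : right_edges t k%:Z = (2 ^ (t - k))%N.
Proof. exact: nedges_nat. Qed.

Lemma left_edges_opp (t : nat) (x : int) : left_edges t (- x) = right_edges t x.
Proof. by rewrite /left_edges /right_edges nedges_opp. Qed.

Lemma right_edges_opp (t : nat) (x : int) : right_edges t (- x) = left_edges t x.
Proof. by rewrite -left_edges_opp opprK. Qed.

(** * Firing moves described by two blocks of chips *)

(** Ranks within [S] are distinct and below [#|S|], so they run through [0, ..., #|S| - 1] exactly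
    once. *)
Lemma card_rank_lt (n : nat) (S : {set 'I_n}) (a : nat) : (a <= #|S|)%N ->
  #|[set i in S | (#|[set j in S | (j < i)%N]| < a)%N]| = a.
Proof.
move=> le_aS; pose rk (i : 'I_n) := #|[set j in S | (j < i)%N]|.
have rkS (i j : 'I_n) : i \in S -> (i < j)%N -> (rk i < rk j)%N.
  move=> iS lt_ij; apply/proper_card/properP; split.
    by apply/subsetP => l; rewrite !inE => /andP[-> /ltn_trans->].
  by exists i; rewrite !inE iS ?ltnn.
have rk_lt i : i \in S -> (rk i < #|S|)%N.
  move=> iS; apply/proper_card/properP; split.
    by apply/subsetP => l; rewrite !inE => /andP[].
  by exists i; rewrite // !inE ltnn andbF.
have rk_inj : {in S &, injective rk}.
  move=> i j iS jS eq_rk; apply/val_inj; case: (ltngtP i j) => // lt_ij.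
    by have := rkS _ _ iS lt_ij; rewrite eq_rk ltnn.
  by have := rkS _ _ jS lt_ij; rewrite eq_rk ltnn.
have perm_rk : perm_eq (map rk (enum S)) (iota 0 #|S|).
  have Umap : uniq (map rk (enum S)).
    rewrite map_inj_in_uniq ?enum_uniq // => i j.
    by rewrite !mem_enum; apply: rk_inj.
  have sub : {subset map rk (enum S) <= iota 0 #|S|}.
    by move=> _ /mapP[i + ->]; rewrite mem_enum mem_iota => /rk_lt.
  apply: uniq_perm; rewrite ?iota_uniq //.
  by case: (uniq_min_size Umap sub); rewrite ?size_iota ?size_map ?cardE.
have -> : #|[set i in S | (rk i < a)%N]| = count (fun r => (r < a)%N) (map rk (enum S)).
  rewrite count_map -size_filter cardE; congr size.
  rewrite /enum_mem -filter_predI; apply: eq_filter => i.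
  by rewrite !inE andbC.
rewrite (permP perm_rk) -(subnKC le_aS) iotaD count_cat.
have /eqP -> : count (fun r => (r < a)%N) (iota 0 a) == a.
  by rewrite -[X in _ == X](size_iota 0 a) -all_count; apply/allP => r; rewrite mem_iota.
rewrite (_ : count _ _ = 0)%N ?addn0 //; apply/eqP.
rewrite -leqn0 leqNgt -has_count; apply/hasPn => r.
by rewrite mem_iota add0n -leqNgt => /andP[].
Qed.

(** Unlike the rank condition in [fire], this description treats left and right alike, so it can be
    mirrored. *)
Record split_fire (t n : nat) (c c' : config n) (x : int) (L R : {set 'I_n}) : Prop :=
  SplitFire {
    split_atL : forall i, i \in L -> c i = x;
    split_atR : forall i, i \in R -> c i = x;
    split_cardL : #|L| = left_edges t x;
    split_cardR : #|R| = right_edges t x;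
    split_lt : forall i j, i \in L -> j \in R -> (i < j)%N;
    split_fireL : forall i, i \in L -> c' i = x - 1;
    split_fireR : forall i, i \in R -> c' i = x + 1;
    split_fireN : forall i, i \notin L -> i \notin R -> c' i = c i }.

Lemma fire_split (t n : nat) (c c' : config n) :
  fire t c c' -> exists x L R, split_fire t c c' x L R.
Proof.
case=> x [S [Sx cardS ->]].
pose L := [set i in S | (#|[set j in S | (j < i)%N]| < left_edges t x)%N].
have subL : L \subset S by apply/subsetP => i; rewrite !inE => /andP[].
have cardL : #|L| = left_edges t x by apply: card_rank_lt; rewrite cardS leq_addr.
have cx i : i \in S -> c i = x by move=> /(subsetP Sx); rewrite inE => /eqP.
exists x, L, (S :\: L); split=> //.
- by move=> i /(subsetP subL)/cx.
- by move=> i /setDP[/cx].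
- by rewrite cardsD (setIidPr subL) cardS cardL addKn.
- move=> i j; rewrite !inE => /andP[iS lt_i] /andP[+ jS].
  rewrite jS /= -leqNgt => le_j; rewrite ltnNge; apply/negP => le_ji.
  have := leq_trans lt_i le_j; rewrite ltnNge => /negP; apply.
  apply/subset_leq_card/subsetP => l; rewrite !inE => /andP[-> lt_l] /=.
  exact: leq_trans lt_l le_ji.
- by move=> i; rewrite ffunE inE => /andP[-> ->].
- by move=> i; rewrite ffunE !inE => /andP[+ iS]; rewrite iS /= => /negPf->.
- move=> i; rewrite ffunE !inE.
  by case: (i \in S) => //= ->.
Qed.

(** * Reflection of sites and labels *)

(** Reversing labels along with sites preserves the rule that smaller chips go left, so only one
    half of the line needs study. *)
Definition mirror (n : nat) (c : config n) : config n := [ffun i => - c (rev_ord i)].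

Lemma mirrorK (n : nat) : involutive (@mirror n).
Proof. by move=> c; apply/ffunP => i; rewrite !ffunE rev_ordK opprK. Qed.

Lemma mirror_init (n : nat) : mirror (init_config n) = init_config n.
Proof. by apply/ffunP => i; rewrite !ffunE oppr0. Qed.

Lemma card_rev_ord (n : nat) (A : {set 'I_n}) : #|[set i | rev_ord i \in A]| = #|A|.
Proof. by rewrite -(card_preimset A (@rev_ord_inj n)) /preimset. Qed.

Lemma split_fire_mirror (t n : nat) (c c' : config n) (x : int) (L R : {set 'I_n}) :
  split_fire t c c' x L R ->
  split_fire t (mirror c) (mirror c') (- x)
    [set i | rev_ord i \in R] [set i | rev_ord i \in L].
Proof.
case=> cL cR aL aR ltLR c'L c'R c'N; split; rewrite ?card_rev_ord.
- by move=> i; rewrite inE ffunE => /cR->.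
- by move=> i; rewrite inE ffunE => /cL->.
- by rewrite left_edges_opp.
- by rewrite right_edges_opp.
- move=> i j; rewrite !inE => iR jL; have := ltLR _ _ jL iR => /=.
  by have := ltn_ord i; have := ltn_ord j; lia.
- by move=> i; rewrite inE ffunE => /c'R->; lia.
- by move=> i; rewrite inE ffunE => /c'L->; lia.
- by move=> i; rewrite !inE !ffunE => iR iL; rewrite c'N.
Qed.

Lemma stable_mirror (t n : nat) (c : config n) : stable t c -> stable t (mirror c).
Proof.
move=> st x; rewrite -(opprK x); move: (- x) => y.
rewrite left_edges_opp right_edges_opp addnC.
apply: leq_trans (st y); rewrite ltnS -[leqRHS]card_rev_ord subset_leq_card //.
by apply/subsetP => i; rewrite !inE !ffunE eqr_opp.
Qed.

(** * Chips beyond a site, and the effect of a firing on them *)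

Definition above (n : nat) (c : config n) (k : nat) : {set 'I_n} :=
  [set i | k%:Z <= c i].

Lemma above_mono (n : nat) (c : config n) (j k : nat) :
  (j <= k)%N -> above c k \subset above c j.
Proof. by move=> le_jk; apply/subsetP => i; rewrite !inE; lia. Qed.

Lemma chips_at_above (n : nat) (c : config n) (k : nat) :
  chips_at c k%:Z = above c k :\: above c k.+1.
Proof. by apply/setP => i; rewrite !inE; lia. Qed.

Lemma card_chips_at (n : nat) (c : config n) (k : nat) :
  (#|chips_at c k%:Z| + #|above c k.+1| = #|above c k|)%N.
Proof.
rewrite chips_at_above -[RHS](cardsID (above c k.+1)) addnC.
by rewrite (setIidPr (above_mono c (leqnSn k))).
Qed.

(** The last term counts the chips at negative sites. *)
Lemma card_chips_at0 (n : nat) (c : config n) :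
  (#|above c 1| + #|chips_at c 0| + #|above (mirror c) 1| = n)%N.
Proof.
have -> : #|above (mirror c) 1| = #|~: above c 0|.
  rewrite -card_rev_ord; congr #|pred_of_set _|.
  by apply/setP => i; rewrite !inE ffunE rev_ordK; lia.
rewrite [(#|above c 1| + _)%N]addnC (card_chips_at c 0) cardsC card_ord //.
Qed.

Section Fire.

Variables (t n : nat) (c c' : config n) (x : int) (L R : {set 'I_n}).
Hypothesis F : split_fire t c c' x L R.

Lemma split_disjoint i : i \in L -> i \in R -> false.
Proof. by move=> iL iR; have := split_lt F iL iR; rewrite ltnn. Qed.

Lemma split_sub : L :|: R \subset chips_at c x.
Proof.
apply/subsetP => i; rewrite !inE => /orP[/(split_atL F)->|/(split_atR F)->] //.
Qed.

Lemma split_card : #|L :|: R| = (left_edges t x + right_edges t x)%N.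
Proof.
rewrite cardsU (split_cardL F) (split_cardR F) (_ : L :&: R = set0) ?cards0 ?subn0 //.
by apply/setP => i; rewrite !inE; apply/negP => /andP[iL /(split_disjoint iL)].
Qed.

Lemma split_all : #|chips_at c x| = (left_edges t x + right_edges t x)%N ->
  chips_at c x = L :|: R.
Proof.
by move=> card_x; apply/esym/eqP; rewrite eqEcard split_sub split_card card_x /=.
Qed.

Lemma split_ge : (left_edges t x + right_edges t x <= #|chips_at c x|)%N.
Proof. by rewrite -split_card subset_leq_card ?split_sub. Qed.

Variant fired_spec (i : 'I_n) : bool -> bool -> int -> int -> Prop :=
  | FiredL of i \in L : fired_spec i true false x (x - 1)
  | FiredR of i \in R : fired_spec i false true x (x + 1)
  | FiredN : fired_spec i false false (c i) (c i).

Lemma firedP i : fired_spec i (i \in L) (i \in R) (c i) (c' i).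
Proof.
case: (boolP (i \in L)) => iL.
  rewrite (split_fireL F iL) (split_atL F iL).
  by case: (boolP (i \in R)) => [/(split_disjoint iL)//|_]; constructor.
case: (boolP (i \in R)) => iR.
  by rewrite (split_fireR F iR) (split_atR F iR); constructor.
by rewrite (split_fireN F iL iR); constructor.
Qed.

Lemma above_fire_neq (k : nat) : k%:Z != x -> k%:Z != x + 1 -> above c' k = above c k.
Proof. by move=> kx kx1; apply/setP => i; rewrite !inE; case: firedP => *; lia. Qed.

Lemma above_fireR (k : nat) : k%:Z = x + 1 -> above c' k = above c k :|: R.
Proof. by move=> kx; apply/setP => i; rewrite !inE; case: firedP => *; lia. Qed.

Lemma above_fireL (k : nat) : k%:Z = x -> above c' k = above c k :\: L.
Proof. by move=> kx; apply/setP => i; rewrite !inE; case: firedP => *; lia. Qed.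

Lemma card_above_fireR (k : nat) : k%:Z = x + 1 ->
  #|above c' k| = (#|above c k| + right_edges t x)%N.
Proof.
move=> kx; rewrite above_fireR // cardsU (split_cardR F).
rewrite (_ : _ :&: R = set0) ?cards0 ?subn0 //.
apply/setP => i; rewrite !inE; apply/negP => /andP[+ /(split_atR F) cx]; rewrite cx; lia.
Qed.

Lemma card_above_fireL (k : nat) : k%:Z = x ->
  (#|above c' k| + left_edges t x = #|above c k|)%N.
Proof.
move=> kx; rewrite above_fireL // -(split_cardL F) -[RHS](cardsID L) addnC.
congr (_ + _)%N; apply/eq_card => i; rewrite !inE.
by case: (boolP (i \in L)) => [/(split_atL F)->|]; rewrite ?andbF // andbT; lia.
Qed.

Definition upclosed (T : {set 'I_n}) := forall i j : 'I_n, i \in T -> (i < j)%N -> j \in T.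

(** A chip of [T] in [L] would force all of [R], whose chips are larger, into [T]; then [T] would
    have more than [#|R|] elements. *)
Lemma upclosed_notinL (T : {set 'I_n}) i :
  upclosed T -> (#|T| <= right_edges t x)%N -> i \in T -> i \notin L.
Proof.
move=> upT leT iT; apply/negP => iL.
have : i |: R \subset T.
  by rewrite subUset sub1set iT; apply/subsetP => j /(split_lt F iL) /(upT _ _ iT).
move=> /subset_leq_card; rewrite cardsU1 (split_cardR F).
case: (boolP (i \in R)) => [/(split_disjoint iL)//|_]; lia.
Qed.

End Fire.

(** * The sets of largest chips and the one-sided invariant *)

(** These are the sets T_j; the inequality is stated additively to avoid truncated subtraction. *)
Definition top (t j : nat) : {set 'I_(2 ^ (t + 2))} :=
  [set i : 'I_(2 ^ (t + 2)) | (2 ^ (t + 2) <= i + 2 ^ (t.+1 - j))%N].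

Lemma card_ord_lt (n b : nat) : (b <= n)%N -> #|[set i : 'I_n | (i < b)%N]| = b.
Proof.
move=> le_bn; have w_inj : injective (widen_ord le_bn).
  by move=> u v /(congr1 val) /= eq_uv; apply: val_inj.
rewrite -[RHS]card_ord -(card_imset _ w_inj).
congr #|pred_of_set _|; apply/setP => i; rewrite inE; apply/idP/imsetP.
  by move=> lt_i; exists (Ordinal lt_i) => //; apply/val_inj.
by case=> l _ ->; rewrite /= ltn_ord.
Qed.

Lemma card_top (t j : nat) : #|top t j| = (2 ^ (t.+1 - j))%N.
Proof.
have le_p : (2 ^ (t.+1 - j) <= 2 ^ (t + 2))%N by rewrite leq_exp2l //; lia.
have -> : top t j = ~: [set i : 'I__ | (i < 2 ^ (t + 2) - 2 ^ (t.+1 - j))%N].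
  by apply/setP => i; rewrite !inE -leqNgt leq_subLR (addnC _ (nat_of_ord i)).
by rewrite cardsCs setCK card_ord card_ord_lt ?leq_subr // subKn.
Qed.

Lemma top_upclosed (t j : nat) : upclosed (top t j).
Proof. by move=> i l; rewrite !inE => le_i lt_il; lia. Qed.

Lemma top_mono (t j k : nat) : (j <= k)%N -> top t k \subset top t j.
Proof.
move=> le_jk; apply/subsetP => i; rewrite !inE => /leq_trans; apply.
by rewrite leq_add2l leq_exp2l //; lia.
Qed.

(* [m] is the number of firings at 0, and [d j] the number of firings at [j] minus that at [j.+1].
   The first firing at site 1 may leave chips there unless [t = 0]: hence the shift by [t == 0] in
   the thresholds of [ri_top1] and [ri_top0], which say that site 1 has since been emptied. *)
Record right_inv (t m : nat) (c : config (2 ^ (t + 2))) (d : nat -> nat) : Prop :=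
  RightInv {
    ri_card : forall j, #|above c j.+1| = (2 ^ (t - j) * d j)%N;
    ri_le2 : forall j, (d j <= 2)%N;
    ri_le1 : forall j, (t < j)%N -> (d j <= 1)%N;
    ri_eq0 : forall j, (t.+1 < j)%N -> d j = 0%N;
    ri_sum : (\sum_(j < t.+2) d j = m)%N;
    ri_gt0 : (0 < m)%N -> (0 < d 0)%N;
    ri_start : d 1 = 0%N -> d 0 = m;
    ri_above_top : forall j, (j <= t)%N -> above c j.+2 \subset top t j.+1;
    ri_top_above : forall j, (j <= t)%N -> d j = 2%N -> top t j.+1 \subset above c j.+1;
    ri_top_above0 : top t 1 \subset above c 0;
    ri_top_aboveS : forall j, (j < t)%N -> (d j == 2)%N || (0 < d j.+1)%N ->
      top t j.+2 \subset above c j.+1;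
    ri_top1 : (3 <= m + (t == 0))%N -> d 0 = 1%N -> above c 1 \subset top t 1;
    ri_top0 : (4 <= m + (t == 0))%N -> above c 1 \subset top t 0 }.

Lemma right_inv_init (t : nat) : right_inv 0 (init_config (2 ^ (t + 2))) (fun=> 0%N).
Proof.
have A0 j : above (init_config (2 ^ (t + 2))) j.+1 = set0.
  by apply/setP => i; rewrite !inE ffunE.
split=> //; try by move=> *; lia.
- by move=> j; rewrite A0 cards0 muln0.
- by rewrite big1.
- by move=> j _; rewrite A0 sub0set.
- by apply/subsetP => i _; rewrite inE ffunE.
Qed.

Lemma sum_eq_ord (n j : nat) : (j < n)%N -> (\sum_(k < n) (k == j :> nat) = 1)%N.
Proof.
move=> lt_jn; rewrite (bigD1 (Ordinal lt_jn)) //= eqxx big1 // => k.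
by rewrite -val_eqE /= => /negPf->.
Qed.

(** * Preservation of the invariant by firings away from site 0 *)

Section RightStep.

Variables (t m : nat) (c c' : config (2 ^ (t + 2))) (d : nat -> nat).
Variables (x : int) (L R : {set 'I_(2 ^ (t + 2))}).
Hypotheses (I : right_inv m c d) (F : split_fire t c c' x L R).

Lemma right_step_neg : x < 0 -> right_inv m c' d.
Proof.
move=> x0.
have A j : above c' j.+1 = above c j.+1 by apply: (above_fire_neq F); lia.
(* A firing at [-1] can only add chips to the nonnegative sites. *)
have A0 : above c 0 \subset above c' 0.
  by apply/subsetP => i; rewrite !inE; case: (firedP F) => *; lia.
case: I => *; split=> //; try by move=> *; rewrite A; auto.
exact: subset_trans A0.
Qed.

Lemma right_inv_le_m : (d 0 <= m)%N.
Proof. by rewrite -(ri_sum I) (bigD1 ord0) // leq_addr. Qed.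

(** For [j < t] and [p = 2 ^ (t - j.+1)], the site holds [p * (2 * d j - d j.+1)] chips and needs
    [3 * p]. For [j = t] it holds [d t - d t.+1] and needs 2. For [j > t] the bound [d j <= 1] rules
    the firing out. *)
Lemma fire_right_bound (j : nat) : x = j.+1%:Z ->
  [/\ (j <= t)%N, d j = 2%N, (d j.+1 <= 1)%N & j = t -> d j.+1 = 0%N].
Proof.
move=> xj; have := split_ge F; have := card_chips_at c j.+1.
rewrite -xj (ri_card I) (ri_card I) xj left_edges_nat right_edges_nat -xj.
have dj := ri_le2 I j; have p0 : (0 < 2 ^ (t - j.+1))%N by rewrite expn_gt0.
case: (ltngtP j t) => [lt_jt|lt_tj|eq_jt].
- have -> : (2 ^ (t - j) = 2 * 2 ^ (t - j.+1))%N by rewrite -expnS; congr (_ ^ _)%N; lia.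
  move: (2 ^ _)%N (d j.+1) p0 => p d' p0 eq_x le_x.
  have : (p * (3 + d') <= p * (2 * d j))%N by lia.
  by rewrite leq_pmul2l // => le_d; split=> //; lia.
- have := ri_le1 I lt_tj.
  have -> : (t - j = 0)%N by lia.
  have -> : (t - j.+1 = 0)%N by lia.
  by move=> d1 eq_x le_x; lia.
- have := @ri_le1 _ _ _ _ I j.+1.
  rewrite eq_jt subnn; have -> : (t - t.+1 = 0)%N by lia.
  by rewrite ltnSn eq_jt in dj * => /(_ isT) d1 eq_x le_x; split=> //; lia.
Qed.

(** The differences after a firing at [j.+1]; the value 1 at [j] is [d j - 1], since such a firing
    requires [d j = 2]. *)
Definition upd_diff (j k : nat) : nat :=
  if k == j then 1 else if k == j.+1 then (d k).+1 else d k.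

Lemma right_step_pos (j : nat) : x = j.+1%:Z -> right_inv m c' (upd_diff j).
Proof.
move=> xj; have [le_jt dj2 dj1 djt] := fire_right_bound xj.
have lE : left_edges t x = (2 ^ (t - j))%N by rewrite xj left_edges_nat.
have rE : right_edges t x = (2 ^ (t - j.+1))%N by rewrite xj right_edges_nat.
have AN k : k != j.+1 -> k != j.+2 -> above c' k = above c k.
  by move=> *; apply: (above_fire_neq F); lia.
have AL : above c' j.+1 = above c j.+1 :\: L by apply: (above_fireL F); lia.
have AR : above c' j.+2 = above c j.+2 :|: R by apply: (above_fireR F); lia.
have subL : above c' j.+1 \subset above c j.+1 by rewrite AL subsetDl.
have subR : above c j.+2 \subset above c' j.+2 by rewrite AR subsetUl.
have uj : upd_diff j j = 1%N by rewrite /upd_diff eqxx.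
have ujS : upd_diff j j.+1 = (d j.+1).+1 by rewrite /upd_diff eqxx ifF //; lia.
have uN k : k != j -> k != j.+1 -> upd_diff j k = d k.
  by move=> kj kj1; rewrite /upd_diff (negPf kj) (negPf kj1).
have card' k : #|above c' k.+1| = (2 ^ (t - k) * upd_diff j k)%N.
  case: (eqVneq k j) => [->|kj].
    have := card_above_fireL F (esym xj); rewrite lE uj (ri_card I) dj2; lia.
  case: (eqVneq k j.+1) => [->|kj1].
    rewrite (card_above_fireR F) ?rE; last by lia.
    by rewrite ujS (ri_card I) mulnS addnC.
  by rewrite uN // -(ri_card I) AN //; lia.
have above_top' k : (k <= t)%N -> above c' k.+2 \subset top t k.+1.
  move=> le_kt; case: (eqVneq k j) => [->|kj]; last first.
    apply: subset_trans (ri_above_top I le_kt).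
    case: (eqVneq k.+1 j) => [->//|kj']; rewrite AN //; lia.
  rewrite AR subUset (ri_above_top I le_jt) /=.
  apply/subsetP => i iR; apply/negPn/negP => iT.
  (* Chips of [top t j.+1] exceed [i], hence avoid [L]. But the right-hand set has only
     [2 ^ (t - j) - 1] elements, one fewer than [top t j.+1]. *)
  have sub_top : top t j.+1 \subset (above c j.+1 :\: (L :|: R)) :|: (R :\ i).
    apply/subsetP => l lT; have := subsetP (ri_top_above I le_jt dj2) l lT.
    have li : (i <= l)%N.
      rewrite leqNgt; apply/negP => lt_li; move/negP: iT; apply.
      exact: top_upclosed lt_li.
    rewrite !inE => -> ; rewrite andbT; case: (boolP (l \in L)) => [lL|_ /=].
      by have := split_lt F lL iR; rewrite ltnNge li.
    case: (boolP (l \in R)) => //= _; rewrite andbT; apply/eqP => eq_li.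
    by move: lT; rewrite eq_li (negPf iT).
  have := leq_trans (subset_leq_card sub_top) (leq_card_setU _ _).
  have subLR : L :|: R \subset above c j.+1.
    by apply/subsetP => l /(subsetP (split_sub F)); rewrite !inE => /eqP->; lia.
  rewrite cardsD (setIidPr subLR) (split_card F) lE rE (ri_card I) dj2 card_top subSS.
  have := cardsD1 i R; rewrite iR (split_cardR F) rE.
  have : (2 ^ (t - j.+1) <= 2 ^ (t - j))%N by rewrite leq_exp2l //; lia.
  lia.
have notL k : (j < k)%N -> (k <= t)%N -> forall i, i \in top t k.+1 -> i \notin L.
  move=> lt_jk le_kt i; apply: (upclosed_notinL F (@top_upclosed t _)).
  rewrite card_top rE leq_exp2l //; lia.
have top_above' k : (k <= t)%N -> upd_diff j k = 2%N -> top t k.+1 \subset above c' k.+1.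
  move=> le_kt; case: (eqVneq k j) => [->|kj]; first by rewrite uj.
  case: (eqVneq k j.+1) => [kj1|kj1]; last first.
    by rewrite uN // => dk2; rewrite AN ?(ri_top_above I) //; lia.
  subst k; rewrite ujS => -[dj1']; apply/subsetP => i iT.
  have ci0 : i \in above c j.+1.
    by apply: (subsetP (ri_top_aboveS I _ _)) iT; rewrite ?dj2 //; lia.
  (* For [d j = 2] and [d j.+1 = 1] the site holds exactly as many chips as it fires, so those of
     [top t j.+2] found there all go right. *)
  have all_fired : chips_at c x = L :|: R.
    apply: (split_all F); have := card_chips_at c j.+1; rewrite -xj !(ri_card I).
    rewrite dj2 dj1' lE rE.
    have -> : (2 ^ (t - j) = 2 * 2 ^ (t - j.+1))%N by rewrite -expnS; congr (_ ^ _)%N; lia.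
    lia.
  rewrite AR in_setU; case: (boolP (i \in above c j.+2)) => //= ci'.
  have : i \in chips_at c x by rewrite xj chips_at_above in_setD ci0 ci'.
  by rewrite all_fired in_setU (negPf (notL _ (ltnSn j) le_kt _ iT)).
(* By [ri_start], [d 1 = 0] would give [m = d 0 = 2]; this excludes the first firing at site 1,
   which may leave chips behind. *)
have dS_gt0 : (3 <= m + (t == 0))%N -> j = 0%N -> (0 < t)%N -> d j.+1 = 1%N.
  move=> m3 j0 t0; subst j; rewrite eqn0Ngt t0 /= addn0 in m3.
  case: (posnP (d 1)) => [d1|]; last by lia.
  by move: m3; rewrite -(ri_start I d1) dj2.
split=> //.
- move=> k; rewrite /upd_diff; case: eqP => // _.
  by case: eqP => [->|_]; [lia | exact: (ri_le2 I)].
- move=> k lt_tk; case: (eqVneq k j) => [->|kj]; first by rewrite uj.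
  case: (eqVneq k j.+1) => [kj1|kj1]; last by rewrite uN // (ri_le1 I).
  by rewrite kj1 ujS djt //; lia.
- by move=> k lt_k; rewrite uN ?(ri_eq0 I) //; lia.
(* One unit moves from [j] to [j.+1]; indicators on both sides avoid subtraction. *)
- have : (\sum_(k < t.+2) (upd_diff j k + (k == j :> nat)) =
          \sum_(k < t.+2) (d k + (k == j.+1 :> nat)))%N.
    apply: eq_bigr => k _; rewrite /upd_diff.
    case: (eqVneq (k : nat) j) => [->|kj]; first by rewrite dj2; case: eqP => //; lia.
    by case: eqP => [->|]; lia.
  by rewrite !big_split /= !sum_eq_ord ?(ri_sum I) //; lia.
- move=> m0; case: (eqVneq 0%N j) => [<-|j0]; first by rewrite /upd_diff.
  by rewrite uN ?(ri_gt0 I).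
- case: (eqVneq 0%N j) => [j0|j0]; first by subst j; rewrite ujS.
  case: (eqVneq 1%N j) => [j1|j1]; first by subst j; rewrite uj.
  by rewrite (uN 1%N) ?(uN 0%N) //; exact: (ri_start I).
- by rewrite AN // (ri_top_above0 I).
- move=> k lt_kt; case: (eqVneq k j) => [kj|kj].
    subst k => _; move: (lt_kt) => lt_jt.
    apply/subsetP => i iT; rewrite AL in_setD (notL j.+1) //=.
    by apply: (subsetP (ri_top_aboveS I _ _)) iT; rewrite ?dj2.
  case: (eqVneq k j.+1) => [kj1|kj1].
    case: (eqVneq (upd_diff j k) 2%N) => [u2 _|_ /=].
      by apply: subset_trans (top_above' _ _ u2); rewrite ?top_mono //; lia.
    rewrite uN; [move=> dk | lia | lia].
    have := ri_top_aboveS I lt_kt; rewrite dk orbT => /(_ isT) sub_old.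
    by subst k; apply: subset_trans subR.
  rewrite AN; [|lia|lia]; rewrite uN // => prem; apply: (ri_top_aboveS I) => //.
  (* For [k.+1 = j] the premise already held before the firing, because [d j = 2]. *)
  case: (eqVneq k.+1 j) prem => [kj'|kj']; first by rewrite kj' dj2 orbT.
  by rewrite uN.
- move=> m3; case: (eqVneq 0%N j) => [j0 _|j0]; last first.
    by rewrite uN // AN //; exact: (ri_top1 I).
  subst j; apply: subset_trans (above_top' 0%N _) => //.
  (* Site 1 is now empty: both sets have [2 ^ t] chips. *)
  have: above c' 2 == above c' 1.
    rewrite eqEcard above_mono // !card' uj ujS /=.
    case: (posnP t) => [t0|t0]; first by rewrite djt // t0.
    by rewrite dS_gt0 // -{1}(prednK t0) !subn0 subn1 /= expnS; lia.
  by move=> /eqP->.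
- move=> m4; case: (eqVneq 0%N j) => [j0|j0]; last by rewrite AN // (ri_top0 I).
  by subst j; apply: subset_trans (ri_top0 I m4).
Qed.

End RightStep.

(** * Preservation of the invariant by firings at site 0 *)

Section ZeroStep.

Variables (t m : nat) (c c' : config (2 ^ (t + 2))) (d e : nat -> nat).
Variables (L R : {set 'I_(2 ^ (t + 2))}).
Hypotheses (I : right_inv m c d) (J : right_inv m (mirror c) e).
Hypothesis F : split_fire t c c' 0 L R.

Lemma right_edges0 : right_edges t 0 = (2 ^ t)%N.
Proof. by rewrite -[0]/(Posz 0) right_edges_nat subn0. Qed.

(** Of the [4 * 2 ^ t] chips at least [2 * 2 ^ t] are at 0, so [d 0 + e 0 <= 2]. Both terms vanish
    if [m = 0], and otherwise both are positive, hence 1, and the site holds no chips beyond those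
    fired. *)
Lemma fire0_bound :
  [/\ d 0 = e 0, (d 0 <= 1)%N, d 0 = 0%N -> m = 0%N &
      d 0 = 1%N -> chips_at c 0 = L :|: R].
Proof.
have card4 : (2 ^ (t + 2) = 4 * 2 ^ t)%N by rewrite expnD mulnC.
have := etrans (card_chips_at0 c) card4; rewrite (ri_card I) (ri_card J) subn0.
have p0 : (0 < 2 ^ t)%N by rewrite expn_gt0.
have := split_ge F; rewrite left_edges0 right_edges0.
have dm := right_inv_le_m I; have em := right_inv_le_m J.
have := ri_gt0 I; have := ri_gt0 J.
have all0 := split_all F; rewrite left_edges0 right_edges0 in all0.
move: (2 ^ t)%N p0 all0 => p p0 all0 e0 d0 le_x eq_x.
have : (p * (d 0 + e 0 + 2) <= p * 4)%N by lia.
rewrite leq_pmul2l // => le4.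
have de : d 0 = e 0 by case: (posnP m) => m0; lia.
split=> //; [lia | by case: (posnP m) => m0; lia | move=> d1; apply: all0].
by move: eq_x; rewrite -de d1; lia.
Qed.

Lemma right_step0 : right_inv m.+1 c' (fun k => if k == 0%N then (d 0).+1 else d k).
Proof.
have [de d1 dm dall] := fire0_bound.
have rE := right_edges0.
have A k : above c' k.+2 = above c k.+2 by apply: (above_fire_neq F); lia.
have AR : above c' 1 = above c 1 :|: R by apply: (above_fireR F).
have subR : above c 1 \subset above c' 1 by rewrite AR subsetUl.
have notL i : i \in top t 1 -> i \notin L.
  by apply: (upclosed_notinL F (@top_upclosed t _)); rewrite card_top rE subSS subn0.
have top1 : d 0 = 1%N -> top t 1 \subset above c' 1.
  move=> d01; apply/subsetP => i iT; have := subsetP (ri_top_above0 I) i iT.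
  rewrite AR in_setU; case: (boolP (i \in above c 1)) => //= ci' ci.
  have : i \in chips_at c 0 by rewrite (chips_at_above c 0) in_setD ci ci'.
  by rewrite dall // in_setU (negPf (notL _ iT)).
split.
- case=> [|k] /=; last by rewrite A (ri_card I).
  by rewrite (card_above_fireR F) // (ri_card I) rE subn0 mulnS addnC.
- by case=> [|k] /=; [lia | exact: (ri_le2 I)].
- by case=> [|k] //=; exact: (ri_le1 I).
- by case=> [|k] //=; exact: (ri_eq0 I).
- by rewrite big_ord_recl /= -(ri_sum I) [in RHS]big_ord_recl.
- by [].
- by move=> /= /(ri_start I)->.
- by move=> k le_kt; rewrite A (ri_above_top I).
- case=> [|k] le_kt /= dk; first by apply: top1; lia.
  by rewrite A (ri_top_above I).
- apply/subsetP => i iT; have := subsetP (ri_top_above0 I) i iT; rewrite !inE.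
  by have := notL i iT; case: (firedP F) => *; lia.
- case=> [|k] lt_kt /=; last by rewrite A; exact: (ri_top_aboveS I).
  case: (eqVneq (d 0) 1%N) => [d01 _|d01].
    by apply: subset_trans (top1 d01); apply: top_mono.
  have -> /= : ((d 0).+1 == 2)%N = false by lia.
  move=> dk; apply: subset_trans subR.
  by apply: (ri_top_aboveS I) => //; rewrite dk orbT.
(* Vacuous: a new difference of 1 means that this is the first firing at 0. *)
- move=> m3 /= -[/dm m0]; rewrite m0 in m3; case: (t == 0%N) m3 => //=.
- move=> m4; have d01 : d 0 = 1%N.
    by case: (posnP (d 0)) => [/dm m0|]; [move: m4; rewrite m0; case: (t == 0%N) | lia].
  have m3 : (3 <= m + (t == 0%N))%N by lia.
  rewrite AR subUset; apply/andP; split.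
    by apply: subset_trans (ri_top1 I m3 d01) _; apply: top_mono.
  (* [B] consists of the chips at negative sites. The mirrored [ri_top1] and a count identify it
     with the [2 ^ t] smallest chips. *)
  pose B := [set l | rev_ord l \in above (mirror c) 1].
  have cardB : #|B| = (2 ^ t)%N by rewrite card_rev_ord (ri_card J) -de d01 muln1 subn0.
  have le_t : (2 ^ t <= 2 ^ (t + 2))%N by rewrite leq_exp2l //; lia.
  have defB : B = [set l : 'I__ | (l < 2 ^ t)%N].
    apply/eqP; rewrite eqEcard cardB card_ord_lt // leqnn andbT.
    have e01 : e 0 = 1%N by rewrite -de.
    apply/subsetP => l; rewrite /B in_set => /(subsetP (ri_top1 J m3 e01)).
    rewrite !inE subSS subn0 /=.
    by have := ltn_ord l; lia.
  apply/subsetP => i iR.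
  have iB : i \notin B by rewrite !inE ffunE rev_ordK (split_atR F iR).
  have le_ti : (2 ^ t <= i)%N by move: iB; rewrite defB inE -leqNgt.
  (* The disjoint sets [L] and [B] put [2 ^ t.+1] chips below [i], so [i] belongs to the upper half
     [top t 0]. *)
  have : L :|: B \subset [set l : 'I__ | (l < i)%N].
    rewrite subUset; apply/andP; split; apply/subsetP => l.
      by rewrite inE => lL; apply: (split_lt F).
    by rewrite defB !inE => /leq_trans; apply.
  move=> /subset_leq_card; rewrite card_ord_lt ?(ltnW (ltn_ord i)) // cardsU cardB.
  rewrite (split_cardL F) left_edges0 (_ : L :&: B = set0).
    have card4 : (2 ^ (t + 2) = 4 * 2 ^ t)%N by rewrite expnD mulnC.
    by rewrite cards0 subn0 inE subn0 expnS; lia.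
  apply/setP => l; rewrite !inE ffunE rev_ordK.
  by apply/negP => /andP[/(split_atL F)->].
Qed.

End ZeroStep.

(** * The invariant on both sides of 0 *)

(** The two sides share [m], the number of firings at 0; this is what couples them. *)
Definition chip_inv (t : nat) (c : config (2 ^ (t + 2))) : Prop :=
  exists m d e, right_inv m c d /\ right_inv m (mirror c) e.

Lemma chip_inv_step (t : nat) (c c' : config (2 ^ (t + 2))) :
  chip_inv c -> fire t c c' -> chip_inv c'.
Proof.
case=> m [d [e [I J]]] /fire_split[x [L [R F]]].
have F' := split_fire_mirror F.
case: (ltrgtP x 0) => [x0|x0|x0].
- exists m, d, (upd_diff e `|x|.-1); split; first exact: (right_step_neg I F x0).
  by apply: (right_step_pos J F'); lia.
- exists m, (upd_diff d `|x|.-1), e; split; first by apply: (right_step_pos I F); lia.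
  by apply: (right_step_neg J F'); lia.
- subst x; rewrite oppr0 in F'.
  do 3 eexists; split; first exact: (right_step0 I J F).
  by apply: right_step0 J _ F'; rewrite mirrorK; exact: I.
Qed.

Lemma reachable_inv (t : nat) (c : config (2 ^ (t + 2))) :
  reachable t (init_config (2 ^ (t + 2))) c -> chip_inv c.
Proof.
elim=> [|c1 c2 _ inv1 step]; last exact: chip_inv_step step.
do 3 eexists; split; first exact: right_inv_init.
by rewrite mirror_init; exact: right_inv_init.
Qed.

(** * Stable configurations *)

Section Final.

Variables (t m : nat) (c : config (2 ^ (t + 2))) (d : nat -> nat).
Hypotheses (I : right_inv m c d) (st : stable t c).

(** Induction outwards: if [d j = 2], then with [p = 2 ^ (t - j.+1)] stability at [j.+1] says
    [p * (4 - d j.+1) < 3 * p]. *)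
Lemma stable_diff j : (j <= t)%N -> d 0 = 2%N -> d j = 2%N.
Proof.
move=> + d0; elim: j => [//|j IH] lt_jt; have dj := IH (ltnW lt_jt).
have := st j.+1; rewrite left_edges_nat right_edges_nat.
have := card_chips_at c j.+1; rewrite !(ri_card I) dj.
have p0 : (0 < 2 ^ (t - j.+1))%N by rewrite expn_gt0.
have -> : (2 ^ (t - j) = 2 * 2 ^ (t - j.+1))%N by rewrite -expnS; congr (_ ^ _)%N; lia.
have := ri_le2 I j.+1; move: (2 ^ _)%N (d j.+1) p0 => p d' p0 le2 eq_x lt_x.
have : (p * 1 < p * d')%N by lia.
by rewrite ltn_pmul2l //; lia.
Qed.

Lemma stable_diff_last : d 0 = 2%N -> d t.+1 = 1%N.
Proof.
move=> d0; have dt := stable_diff (leqnn t) d0.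
have := st t.+1; rewrite left_edges_nat right_edges_nat.
have := card_chips_at c t.+1; rewrite !(ri_card I) dt.
have -> : (t - t.+1 = 0)%N by lia.
by have := ri_le1 I (ltnSn t); rewrite subnn; lia.
Qed.

Lemma stable_sum : d 0 = 2%N -> m = (2 * t + 3)%N.
Proof.
move=> d0; rewrite -(ri_sum I) big_ord_recr /= stable_diff_last //.
rewrite (eq_bigr (fun=> 2%N)) => [|j _]; last by rewrite stable_diff // -ltnS.
by rewrite sum_nat_const card_ord; lia.
Qed.

(** The bounds on [d] make [2 * t + 3] the largest possible sum, reached only if every bound is
    attained. *)
Lemma diff0_of_sum : m = (2 * t + 3)%N -> d 0 = 2%N.
Proof.
rewrite -(ri_sum I) big_ord_recr big_ord_recl /=.
have : (\sum_(j < t) d (bump 0 j) <= \sum_(j < t) 2)%N.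
  by apply: leq_sum => j _; apply: (ri_le2 I).
rewrite sum_nat_const card_ord.
move: (ri_le1 I (ltnSn t)) (ri_le2 I 0); move: (\sum_(j < t) _)%N (d 0) (d t.+1); lia.
Qed.

Lemma stable_above : d 0 = 2%N -> forall j, (j <= t.+1)%N -> above c j.+1 = top t j.
Proof.
move=> d0 j le_jt; apply/eqP; rewrite eqEcard; apply/andP; split.
  case: j le_jt => [_|j le_jt]; last exact: (ri_above_top I).
  (* The threshold 4 is met by [2 * t + 3] when [t > 0]; when [t = 0] the extra [t == 0] supplies
     the missing unit. *)
  by apply: (ri_top0 I); rewrite stable_sum //; case: eqP; lia.
rewrite card_top (ri_card I); case: (ltngtP j t.+1) => [lt_j|//|eq_j]; last 2 first.
- by rewrite ltnNge le_jt.
- rewrite eq_j subnn stable_diff_last //; lia.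
by rewrite stable_diff // mulnC -expnS; apply: eq_leq; congr (_ ^ _)%N; lia.
Qed.

Lemma stable_upclosed : d 0 = 2%N -> forall j, upclosed (above c j.+1).
Proof.
move=> d0 j; case: (leqP j t.+1) => [le_j|lt_j].
  by rewrite stable_above //; exact: top_upclosed.
suff -> : above c j.+1 = set0 by move=> i l; rewrite inE.
by apply/eqP; rewrite -cards_eq0 (ri_card I) (ri_eq0 I) // muln0.
Qed.

End Final.

(** Stability at 0 gives [d 0 + e 0 > 2], so one of them is 2. That side forces [m = 2 * t + 3],
    which carries over to the other side. *)
Lemma stable_diff0 (t m : nat) (c : config (2 ^ (t + 2))) (d e : nat -> nat) :
  right_inv m c d -> right_inv m (mirror c) e -> stable t c -> d 0 = 2%N /\ e 0 = 2%N.
Proof.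
move=> I J st; have card4 : (2 ^ (t + 2) = 4 * 2 ^ t)%N by rewrite expnD mulnC.
have := etrans (card_chips_at0 c) card4; have := st 0.
rewrite (ri_card I) (ri_card J) subn0 left_edges0 right_edges0.
have p0 : (0 < 2 ^ t)%N by rewrite expn_gt0.
have := ri_le2 I 0; have := ri_le2 J 0; move: (2 ^ t)%N p0 => p p0 e2 d2 lt_x eq_x.
have : (p * 2 < p * (d 0 + e 0))%N by lia.
rewrite ltn_pmul2l // => gt2.
have st' := stable_mirror st.
case: (eqVneq (d 0) 2%N) => [d0|d0]; last first.
  have e0 : e 0 = 2%N.
    by move: gt2 d2 e2 d0; clear; move: (d 0) (e 0); lia.
  by rewrite (diff0_of_sum I (stable_sum J st' e0)).
by rewrite (diff0_of_sum J (stable_sum I st d0)).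
Qed.

Theorem theorem3p7 (t : nat) (c : config (2 ^ (t + 2))) :
  reachable t (init_config (2 ^ (t + 2))) c ->
  stable t c ->
  forall a b : 'I_(2 ^ (t + 2)), (a < b)%N -> c a <= c b.
Proof.
move=> /reachable_inv[m [d [e [I J]]]] st a b lt_ab.
have [d0 e0] := stable_diff0 I J st.
have upR := stable_upclosed I st d0.
have upL := stable_upclosed J (stable_mirror st) e0.
rewrite leNgt; apply/negP => lt_ba.
(* If [c a > 0], the up-closed set of chips at sites at least [c a] contains [a], hence [b].
   Otherwise [c b < 0], and the mirrored argument starts from [b]. *)
case: (ltrP 0 (c a)) => [ca0|ca0].
  have : a \in above c (`|c a|.-1).+1 by rewrite inE; lia.
  by move=> /upR/(_ lt_ab); rewrite inE; lia.
have : rev_ord b \in above (mirror c) (`|c b|.-1).+1 by rewrite inE ffunE rev_ordK; lia.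
have lt_rev : (rev_ord b < rev_ord a)%N by have := ltn_ord b; rewrite /=; lia.
by move=> /upL/(_ lt_rev); rewrite inE ffunE rev_ordK; lia.
Qed.
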